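(* Let $\mathbf{o}_R$ be a random vector uniformly distributed on the unit sphere of $\mathbb{R}^3$, let $\mathbf{v}=\mathbf{v}_{\rm Re}+j\,\mathbf{v}_{\rm Im}\in\mathbb{C}^3$ be non-random with linearly independent $\mathbf{v}_{\rm Re},\mathbf{v}_{\rm Im}\in\mathbb{R}^3$, and let $h=\mathbf{o}_R^{\mathsf T}\mathbf{v}\in\mathbb{C}$. Let $v_{\rm Re}=\|\mathbf{v}_{\rm Re}\|$, $v_{\rm Im}=\|\mathbf{v}_{\rm Im}\|$, $\rho=\dfrac{\mathbf{v}_{\rm Re}^{\mathsf T}\mathbf{v}_{\rm Im}}{v_{\rm Re}v_{\rm Im}}$, and $$a=\tfrac12\left(v_{\rm Re}^2+v_{\rm Im}^2\right),\qquad b=v_{\rm Re}v_{\rm Im}\sqrt{1-\rho^2},\qquad s_0=a-\sqrt{a^2-b^2}.$$ Then for all $0\le s<s_0$ the cumulative distribution function $F_{|h|^2|\mathbf{v}}(s|\mathbf{v})=\mathrm{P}[|h|^2\le s]$ satisfies $$\frac{s}{2b}\;\le\;F_{|h|^2|\mathbf{v}}(s|\mathbf{v})\;\le\;\frac{s}{2b}\left(1-\frac{s}{s_0}\right)^{-1/2}.$$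
   Context: $j$ is the imaginary unit and $\|\cdot\|$ is the Euclidean norm. *)

(* Defs.v *)
From HB Require Import structures.
From mathcomp Require Import all_boot all_order all_algebra.
From mathcomp Require Import all_classical all_reals all_analysis.
From mathcomp Require Import complex.

Set Implicit Arguments.
Unset Strict Implicit.
Unset Printing Implicit Defensive.

Import Order.TTheory GRing.Theory Num.Theory.

Local Open Scope classical_set_scope.
Local Open Scope ring_scope.

Definition enorm (R : realType) (n : nat) (x : 'cV[R]_n) : R :=
  Num.sqrt ((x^T *m x) ord0 ord0).

(* Points of R^n are n.-tuple R where measurability matters (the library puts
   the product sigma-algebra on tuples, and none on matrices). *)
Definition colv (R : realType) (n : nat) (x : n.-tuple R) : 'cV[R]_n :=
  \col_(i < n) tnth x i.

(* The cone {t u | u in A, |u| = 1, 0 < t <= 1} over the part of A lying on the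
   unit sphere, as a subset of R x R x R. *)
Definition cone (R : realType) (A : set (3.-tuple R)) : set (R * R * R) :=
  [set p | exists t : R, exists u : 3.-tuple R,
    [/\ 0 < t <= 1, A u, enorm (colv u) = 1 &
        p = (t * tnth u (inord 0), t * tnth u (inord 1), t * tnth u (inord 2))]].

(* Surface measure of the part of A lying on the unit sphere S of R^3, via the
   cone construction sigma(E) = 3 * vol {t u | u in E, 0 < t <= 1}; the factor 3
   is the dimension, so that vol(dx) = t^2 dt sigma(du) and sigma(S) = 4 pi. *)
Definition sphere_area (R : realType) (A : set (3.-tuple R)) : \bar R :=
  (3%:E * ((lebesgue_measure \x lebesgue_measure) \x lebesgue_measure)%E
    (cone A))%E.

Definition uniform_on_sphere (R : realType) (d : measure_display)
    (T : measurableType d) (P : probability T R)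
    (o : {RV P >-> 3.-tuple R}) : Prop :=
  forall A : set (3.-tuple R), measurable A ->
    distribution P o A = (sphere_area A / sphere_area [set: 3.-tuple R])%E.

(* Main.v *)
(* Let [Q x = (x . vRe)^2 + (x . vIm)^2], so that [|h|^2 = Q(oR)] and [F s] is
   the normalised volume of [{0 < |x| <= 1, Q x <= s |x|^2}].  In the linear
   coordinates [p = x . vRe], [q = x . vIm], [z = x . n], with [n] the unit
   normal of the plane of [vRe] and [vIm] (Jacobian [b]), one has
   [Q = p^2 + q^2] and [|x|^2 = G + z^2] for a quadratic form
   [0 <= G <= Q / s0] in [(p, q)].  For fixed [(p, q)], put [W = Q / s]; the
   section in [z] is [{W - G <= z^2 <= 1 - G}], of length [2 (beta - alpha)]
   with [beta^2 = 1 - G] and [alpha^2 = W - G].  Since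
   [(beta - alpha) (beta + alpha) = 1 - W] and
   [c (1 + sqrt W) <= beta + alpha <= 1 + sqrt W] for [c = sqrt (1 - s / s0)],
   this length lies between [2 (1 - sqrt W)] and [2 (1 - sqrt W) / c].  The
   former is the length of the section of the circular cone of height [2] over
   the disc [Q <= s], of volume [2/3 s D] with [D] the area of the unit disc;
   the unit ball has volume [4/3 D], and the bounds are the quotients. *)
Require Import Defs.
From HB Require Import structures.
From mathcomp Require Import all_boot all_order all_algebra.
From mathcomp Require Import fingroup perm.
From mathcomp Require Import all_classical all_reals all_analysis.
From mathcomp Require Import measurable_realfun.
From mathcomp Require Import complex ring lra.

Import Order.TTheory GRing.Theory Num.Theory.

Local Open Scope classical_set_scope.
Local Open Scope ring_scope.

(** * Linear change of variables for Lebesgue measure on R^3 *)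

(** Lebesgue measure is determined by its values on intervals []a, b]], so it suffices to compare
    both sides there. For negative [k] the preimage is half-open on the other side, hence the two
    cases. *)
Lemma lebesgue_measure_affine (R : realType) (k c : R)
    (A : set (measurableTypeR R)) : k != 0 -> measurable A ->
  lebesgue_measure A =
  (`|k|%:E * lebesgue_measure ((fun z : R => k * z + c)%R @^-1` A))%E.
Proof.
move=> k0 mA.
pose f : measurableTypeR R -> measurableTypeR R := fun z : R => k * z + c.
have mf : measurable_fun setT f.
  by apply: measurable_funD => //; exact: measurable_funM.
pose nu := mscale (NngNum (normr_ge0 k)) (pushforward (@lebesgue_measure R) f).
have := @lebesgue_measure_unique R (nu mf); apply => // X [[a b] _ <-].
rewrite /nu /mscale /= /pushforward.
have [kn|kp|k0'] := ltgtP k 0; last by rewrite k0' eqxx in k0.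
- rewrite [X in _ = (_ * lebesgue_measure X)%E](_ : _ =
      `[(b - c) / k, (a - c) / k[%classic); last first.
    apply/seteqP; split => z /=; rewrite !in_itv/= /f => /andP[P Q]; apply/andP;
      move: P Q; rewrite ler_ndivrMr// ltr_ndivlMr//; split; lra.
  rewrite !lebesgue_measure_itv/= !lte_fin.
  rewrite (_ : ((b - c) / k < (a - c) / k) = (a < b)).
    case: ifPn => // ab; rewrite ?mule0//.
    by rewrite ltr0_norm// -!EFinB -EFinM; congr EFin; field.
  by rewrite ltr_nM2r ?invr_lt0// ltrD2r.
- rewrite [X in _ = (_ * lebesgue_measure X)%E](_ : _ =
      `](a - c) / k, (b - c) / k]%classic); last first.
    apply/seteqP; split => z /=; rewrite !in_itv/= /f => /andP[P Q]; apply/andP;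
      move: P Q; rewrite ler_pdivlMr// ltr_pdivrMr//; split; lra.
  rewrite !lebesgue_measure_itv/= !lte_fin.
  rewrite (_ : ((a - c) / k < (b - c) / k) = (a < b)).
    case: ifPn => // ab; rewrite ?mule0//.
    by rewrite gtr0_norm// -!EFinB -EFinM; congr EFin; field.
  by rewrite ltr_pM2r ?invr_gt0// ltrD2r.
Qed.

(** Products of equally indexed sets from two increasing exhaustions cover the product: indices [n]
    and [k] of the coordinates are both dominated by [maxn n k]. *)
Lemma product_measure_sigma_finite (d1 d2 : measure_display)
    (T1 : measurableType d1) (T2 : measurableType d2) (R : realType)
    (m1 : {sigma_finite_measure set T1 -> \bar R})
    (m2 : {sigma_finite_measure set T2 -> \bar R}) :
  sigma_finite setT (m1 \x m2)%E.
Proof.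
have /sigma_finiteP[F [TF ndF Foo]] := sigma_finiteT m1.
have /sigma_finiteP[G [TG ndG Goo]] := sigma_finiteT m2.
exists (fun n => F n `*` G n).
  apply/esym/seteqP; split => // -[x y] _.
  have [n _ Fx] : (\bigcup_i F i) x by rewrite -TF.
  have [k _ Gy] : (\bigcup_i G i) y by rewrite -TG.
  exists (maxn n k) => //; split => /=.
  - by have /subsetPset := ndF _ _ (leq_maxl n k); exact.
  - by have /subsetPset := ndG _ _ (leq_maxr n k); exact.
move=> k; have [mF Fk] := Foo k; have [mG Gk] := Goo k.
split; first exact: measurableX.
by rewrite product_measure1E// lte_mul_pinfty// ge0_fin_numE.
Qed.

(* The library attaches the sigma-finite structure of [m1 \x m2] to
   subprobabilities only, hence a constant of its own for plane Lebesgue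
   measure. *)
Definition lebesgue_measure2 (R : realType) :
    set (measurableTypeR R * measurableTypeR R) -> \bar R :=
  (@lebesgue_measure R \x @lebesgue_measure R)%E.

HB.instance Definition _ (R : realType) := Measure.copy (@lebesgue_measure2 R)
  (@lebesgue_measure R \x @lebesgue_measure R)%E.

HB.instance Definition _ (R : realType) :=
  Measure_isSigmaFinite.Build _ _ _ (@lebesgue_measure2 R)
    (@product_measure_sigma_finite _ _ _ _ R (@lebesgue_measure R)
       (@lebesgue_measure R)).

Lemma ord3P (i : 'I_3) : [\/ i = 0, i = 1 | i = 2].
Proof.
case: i => -[|[|[|//]]] p; [exact: Or31 (val_inj _)|exact: Or32 (val_inj _)|].
exact: Or33 (val_inj _).
Qed.

Lemma sum3E (R : nmodType) (F : 'I_3 -> R) : \sum_i F i = F 0 + F 1 + F 2.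
Proof.
rewrite !big_ord_recl big_ord0 addr0 addrA.
by congr (F _ + F _ + F _); exact: val_inj.
Qed.

Lemma lup_decomposition (F : fieldType) (n : nat) (A : 'M[F]_n.+1) :
  exists (s : 'S_n.+1) (L U : 'M[F]_n.+1), [/\ perm_mx s *m A = L *m U,
    forall i j : 'I_n.+1, (i <= j)%N -> L i j = (i == j)%:R &
    forall i j : 'I_n.+1, (j < i)%N -> U i j = 0].
Proof.
have := cormen_lup_correct A; have := cormen_lup_perm A.
have := @cormen_lup_upper _ _ A; have := @cormen_lup_lower _ _ A.
case: (cormen_lup A) => -[P L] U /= Llow Uup /is_perm_mxP[s ->] PA.
by exists s, L, U.
Qed.

Section linear_change_of_variables.
Variable R : realType.
Notation mR := (measurableTypeR R).
Notation mu := (@lebesgue_measure R).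
Notation mu2 := (@lebesgue_measure2 R).
Notation mu3 := (mu2 \x mu)%E.

(** Both orders of integration give a measure with the same values on rectangles, and such a measure
    is unique. *)
Lemma lebesgue_measure2_swap (A : set (mR * mR)) : measurable A ->
  mu2 A = mu2 ((fun p => (p.2, p.1)) @^-1` A).
Proof.
move=> mA; rewrite /lebesgue_measure2.
rewrite (@product_measure_unique _ _ _ _ _ mu mu
  [the measure _ _ of (mu \x^ mu)%E])//; last first.
  by move=> B C mB mC /=; rewrite product_measure2E.
Qed.

Lemma lebesgue_measure3_zsection (A : set (mR * mR * mR)) : measurable A ->
  mu3 A = (\int[mu]_z mu2 (ysection A z))%E.
Proof.
move=> mA.
rewrite (@product_measure_unique _ _ _ _ _ mu2 mu
  [the measure _ _ of (mu2 \x^ mu)%E])//.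
by move=> B C mB mC /=; rewrite product_measure2E.
Qed.

Lemma lebesgue_measure3_yzsection (A : set (mR * mR * mR)) : measurable A ->
  mu3 A = (\int[mu]_x mu2 [set q | A (x, q.1, q.2)])%E.
Proof.
move=> mA.
rewrite [LHS](fubini_tonelli1 (mu \o xsection A))//.
exact: measurable_fun_xsection.
Qed.

Lemma measurable_swapxy :
  measurable_fun [set: mR * mR * mR] (fun p => (p.1.2, p.1.1, p.2)).
Proof.
apply: measurable_fun_pair => //; apply: measurable_fun_pair => /=;
  exact: measurableT_comp.
Qed.

Lemma measurable_swapyz :
  measurable_fun [set: mR * mR * mR] (fun p => (p.1.1, p.2, p.1.2)).
Proof.
apply: measurable_fun_pair => /=; last exact: measurableT_comp.
apply: measurable_fun_pair => //=; exact: measurableT_comp.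
Qed.

(** Slicing at fixed [z] reduces this to the swap in the plane; [lebesgue_measure3_swapyz] slices at
    fixed [x] instead. *)
Lemma lebesgue_measure3_swapxy (A : set (mR * mR * mR)) : measurable A ->
  mu3 A = mu3 ((fun p => (p.1.2, p.1.1, p.2)) @^-1` A).
Proof.
move=> mA; have mA' : measurable ((fun p => (p.1.2, p.1.1, p.2)) @^-1` A).
  by rewrite -[X in measurable X]setTI; exact: measurable_swapxy.
rewrite (lebesgue_measure3_zsection _ mA) (lebesgue_measure3_zsection _ mA').
apply: eq_integral => z _.
rewrite lebesgue_measure2_swap; last exact: measurable_ysection.
by congr (mu2 _); apply/seteqP; split => y; rewrite /ysection /= !inE.
Qed.

Lemma lebesgue_measure3_swapyz (A : set (mR * mR * mR)) : measurable A ->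
  mu3 A = mu3 ((fun p => (p.1.1, p.2, p.1.2)) @^-1` A).
Proof.
move=> mA; have mA' : measurable ((fun p => (p.1.1, p.2, p.1.2)) @^-1` A).
  by rewrite -[X in measurable X]setTI; exact: measurable_swapyz.
rewrite (lebesgue_measure3_yzsection _ mA) (lebesgue_measure3_yzsection _ mA').
apply: eq_integral => x _; rewrite [LHS]lebesgue_measure2_swap; first by [].
have : measurable_fun [set: mR * mR] (fun q => ((x, q.1), q.2)).
  by apply: measurable_fun_pair => //; exact: measurable_fun_pair.
by move=> /(_ measurableT _ mA); rewrite setTI.
Qed.

Definition linmap (M : 'M[R]_3) (p : mR * mR * mR) : mR * mR * mR :=
  let l i := M i 0 * p.1.1 + M i 1 * p.1.2 + M i 2 * p.2 in (l 0, l 1, l 2).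

Lemma measurable_linmap (M : 'M[R]_3) : measurable_fun setT (linmap M).
Proof.
have ml (a b c : R) : measurable_fun [set: mR * mR * mR]
    (fun p => a * p.1.1 + b * p.1.2 + c * p.2).
  by apply: measurable_funD; [apply: measurable_funD|];
    apply: measurable_funM => //; exact: measurableT_comp.
by apply: measurable_fun_pair; [apply: measurable_fun_pair|]; exact: ml.
Qed.

Lemma linmapM (M N : 'M[R]_3) p : linmap (M *m N) p = linmap M (linmap N p).
Proof.
by rewrite /linmap; congr (_, _, _); rewrite !mxE !sum3E /=; ring.
Qed.

(** Stated with preimages, so that it composes under matrix products and asks only for measurability
    of [linmap M], not for an inverse. *)
Definition scales_volume (M : 'M[R]_3) := forall A : set (mR * mR * mR),
  measurable A -> mu3 A = (`|\det M|%:E * mu3 (linmap M @^-1` A))%E.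

Lemma measurable_linmap_preimage (M : 'M[R]_3) (A : set (mR * mR * mR)) :
  measurable A -> measurable (linmap M @^-1` A).
Proof. by rewrite -[X in _ -> measurable X]setTI; exact: measurable_linmap. Qed.

Lemma scales_volumeM (M N : 'M[R]_3) :
  scales_volume M -> scales_volume N -> scales_volume (M *m N).
Proof.
move=> hM hN A mA; rewrite det_mulmx normrM EFinM -muleA hM//; congr (_ * _)%E.
rewrite hN; last exact: measurable_linmap_preimage.
congr (_ * mu3 _)%E; apply/seteqP; split => p /=; by rewrite linmapM.
Qed.

Lemma scales_volume1 : scales_volume 1%:M.
Proof.
move=> A mA; rewrite det1 normr1 mul1e; congr (mu3 _).
apply/seteqP; split => -[[x y] z] /=; rewrite /linmap !mxE/=;
  by rewrite !(mul0r, mul1r, add0r, addr0).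
Qed.

Definition replace_row (k : 'I_3) (r : 'rV[R]_3) : 'M[R]_3 :=
  \matrix_(i, j) (if i == k then r 0 j else (i == j)%:R).

(** For fixed [x] and [y] the map is affine in [z] with slope [r 0 2], so integrating over sections
    reduces the claim to dimension one. *)
Lemma scales_volume_replace_row2 (r : 'rV[R]_3) :
  r 0 2 != 0 -> scales_volume (replace_row 2 r).
Proof.
move=> r2 A mA.
have -> : \det (replace_row 2 r) = r 0 2.
  rewrite det_trig.
    by rewrite !big_ord_recl big_ord0 !mxE /= mulr1 !mul1r;
      congr (r _ _); exact: val_inj.
  apply/is_trig_mxP => i j; rewrite mxE.
  by case: (ord3P i) => ->; case: (ord3P j) => ->.
rewrite -ge0_integralZl//; last first.
  by apply: measurable_fun_xsection; exact: measurable_linmap_preimage.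
apply: eq_integral => -[x y] _ /=.
rewrite (@lebesgue_measure_affine _ _ (r 0 0 * x + r 0 1 * y) _ r2)//; last first.
  exact: measurable_xsection.
congr (_ * mu _)%E; apply/seteqP; split => z; rewrite /xsection /= !inE /=
  /linmap !mxE /= !(mul0r, mul1r, add0r, addr0) addrC//.
Qed.

Lemma scales_volume_tperm (i j : 'I_3) : scales_volume (perm_mx (tperm i j)).
Proof.
have norm_det (s : 'S_3) : `|\det (perm_mx s : 'M[R]_3)| = 1.
  by rewrite det_perm normrX normrN1 expr1n.
have s01 : scales_volume (perm_mx (tperm 0 1)).
  move=> A mA; rewrite norm_det mul1e (lebesgue_measure3_swapxy _ mA).
  congr (mu3 _); apply/seteqP; split => -[[x y] z] /=; rewrite /linmap !mxE/=;
    rewrite tpermL tpermR tpermD//= !(mul0r, mul1r, add0r, addr0)//.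
have s12 : scales_volume (perm_mx (tperm 1 2)).
  move=> A mA; rewrite norm_det mul1e (lebesgue_measure3_swapyz _ mA).
  congr (mu3 _); apply/seteqP; split => -[[x y] z] /=; rewrite /linmap !mxE/=;
    rewrite tpermL tpermR tpermD//= !(mul0r, mul1r, add0r, addr0)//.
have s02 : scales_volume (perm_mx (tperm 0 2)).
  (* The remaining transposition is the conjugate of one adjacent transposition by the other. *)
  have -> : tperm (0 : 'I_3) (2 : 'I_3) =
      (tperm 1%R 2%R * tperm 0%R 1%R * tperm 1%R 2%R)%g.
    have := tpermJ (0 : 'I_3) 1 (tperm 1 2).
    by rewrite tpermL tpermD// => <-; rewrite conjgE tpermV mulgA.
  rewrite !perm_mxM.
  exact: (scales_volumeM _ _ (scales_volumeM _ _ s12 s01) s12).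
case: (ord3P i) => ->; case: (ord3P j) => ->.
- by rewrite tperm1 perm_mx1; exact: scales_volume1.
- exact: s01.
- exact: s02.
- by rewrite tpermC; exact: s01.
- by rewrite tperm1 perm_mx1; exact: scales_volume1.
- exact: s12.
- by rewrite tpermC; exact: s02.
- by rewrite tpermC; exact: s12.
- by rewrite tperm1 perm_mx1; exact: scales_volume1.
Qed.

Lemma scales_volume_perm (s : 'S_3) : scales_volume (perm_mx s).
Proof.
have [ts -> _] := prod_tpermP s.
elim: ts => [|t ts IH]; first by rewrite big_nil perm_mx1; exact: scales_volume1.
rewrite big_cons perm_mxM.
exact: (scales_volumeM _ _ (scales_volume_tperm _ _) IH).
Qed.

(** Conjugation by the transposition of [k] and [2] moves row [k] to the last place. *)
Lemma scales_volume_replace_row (k : 'I_3) (r : 'rV[R]_3) :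
  r 0 k != 0 -> scales_volume (replace_row k r).
Proof.
move=> rk; set t := tperm k 2.
pose r' : 'rV[R]_3 := \row_j r 0 (t j).
suff -> : replace_row k r = perm_mx t *m replace_row 2 r' *m perm_mx t.
  apply: scales_volumeM; last exact: scales_volume_perm.
  apply: scales_volumeM; first exact: scales_volume_perm.
  by apply: scales_volume_replace_row2; rewrite mxE tpermR.
have tV : t^-1%g = t by rewrite tpermV.
rewrite -row_permE -[X in _ *m perm_mx X]tV -col_permE.
apply/matrixP => i j; rewrite !mxE.
have -> : (i == k) = (t i == 2).
  by rewrite -[LHS](inj_eq (@perm_inj _ t)) /t tpermL.
by rewrite /t tpermK (inj_eq perm_inj).
Qed.

Lemma scales_volume_lower (L : 'M[R]_3) :
  (forall i j : 'I_3, (i < j)%N -> L i j = 0) -> (forall i, L i i != 0) ->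
  scales_volume L.
Proof.
move=> L0 Ld; have D k : scales_volume (replace_row k (row k L)).
  by apply: scales_volume_replace_row; rewrite mxE.
suff -> : L = replace_row 0 (row 0 L) *m replace_row 1 (row 1 L) *m
              replace_row 2 (row 2 L).
  exact: (scales_volumeM _ _ (scales_volumeM _ _ (D 0) (D 1)) (D 2)).
have L01 : L 0 1 = 0 by exact: L0.
have L02 : L 0 2 = 0 by exact: L0.
have L12 : L 1 2 = 0 by exact: L0.
apply/matrixP => i j; rewrite !(mxE, sum3E).
by case: (ord3P i) => ->; case: (ord3P j) => -> /=; rewrite ?L01 ?L02 ?L12; ring.
Qed.

Lemma scales_volume_upper (U : 'M[R]_3) :
  (forall i j : 'I_3, (j < i)%N -> U i j = 0) -> (forall i, U i i != 0) ->
  scales_volume U.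
Proof.
move=> U0 Ud; have D k : scales_volume (replace_row k (row k U)).
  by apply: scales_volume_replace_row; rewrite mxE.
suff -> : U = replace_row 2 (row 2 U) *m replace_row 1 (row 1 U) *m
              replace_row 0 (row 0 U).
  exact: (scales_volumeM _ _ (scales_volumeM _ _ (D 2) (D 1)) (D 0)).
have U10 : U 1 0 = 0 by exact: U0.
have U20 : U 2 0 = 0 by exact: U0.
have U21 : U 2 1 = 0 by exact: U0.
apply/matrixP => i j; rewrite !(mxE, sum3E).
by case: (ord3P i) => ->; case: (ord3P j) => -> /=; rewrite ?U10 ?U20 ?U21; ring.
Qed.

Theorem lebesgue_measure3_linear (M : 'M[R]_3) : \det M != 0 -> scales_volume M.
Proof.
move=> dM; have [s [L [U [PM Llow Uup]]]] := lup_decomposition _ _ M.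
have -> : M = perm_mx s^-1 *m L *m U.
  by rewrite -mulmxA -[L *m U]PM mulmxA -perm_mxM mulVg perm_mx1 mul1mx.
(* The diagonal entries of [U], whose product is [\det U], are nonzero for this reason. *)
have detU : \det U != 0.
  apply: contra dM => /eqP U0; have := congr1 determinant PM.
  rewrite !det_mulmx U0 mulr0 det_perm => /eqP.
  by rewrite mulf_eq0 signr_eq0.
have scL : scales_volume L.
  apply: scales_volume_lower => [i j ij|i]; last by rewrite Llow// eqxx oner_neq0.
  by rewrite Llow ?(ltnW ij)// -val_eqE ltn_eqF.
have scU : scales_volume U.
  apply: scales_volume_upper => // i; apply: contra detU => /eqP Ui.
  rewrite -det_tr det_trig; last by apply/is_trig_mxP => k l kl; rewrite mxE Uup.
  by apply/prodf_eq0; exists i; rewrite // mxE Ui.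
exact: (scales_volumeM _ _ (scales_volumeM _ _ (scales_volume_perm _) scL) scU).
Qed.

End linear_change_of_variables.

(** * Comparison of one-dimensional sections *)

Lemma measurable_le_set (d : measure_display) (T : measurableType d)
    (R : realType) (f g : T -> R) : measurable_fun setT f ->
  measurable_fun setT g -> measurable [set x | f x <= g x].
Proof.
move=> mf mg; rewrite -[X in measurable X]setTI.
have mfg := measurable_fun_ler mf mg.
exact: (mfg measurableT [set true] I).
Qed.

Lemma measurable_lt_set (d : measure_display) (T : measurableType d)
    (R : realType) (f g : T -> R) : measurable_fun setT f ->
  measurable_fun setT g -> measurable [set x | f x < g x].
Proof.
move=> mf mg; rewrite -[X in measurable X]setTI.
have mfg := measurable_fun_ltr mf mg.
exact: (mfg measurableT [set true] I).
Qed.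

Lemma lebesgue_measure_itv_le (R : realType) (a b : R) (x y : bool) : a <= b ->
  lebesgue_measure [set` Interval (BSide x a) (BSide y b)] = (b - a)%:E.
Proof.
move=> ab; rewrite lebesgue_measure_itv/= lte_fin.
have [//|ba] := ltP a b.
by rewrite (_ : b = a) ?subrr//; apply/le_anti; rewrite ab ba.
Qed.

Section section_comparison.
Variable R : realType.

(** The fibre over a point (p, q): [m] is the value of Q and [t] the value of G there, so that
    [t + z ^+ 2] is |x|^2. The strict inequality removes the origin. *)
Definition shell_section (s m t : R) : set R :=
  [set z | 0 < t + z ^+ 2 /\ t + z ^+ 2 <= 1 /\ m <= s * (t + z ^+ 2)].

(** The fibre, where Q equals [m], of the circular cone with base Q <= s at height 0 and apex at
    height 2. *)
Definition cone_section (s m : R) : set R :=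
  [set z | 0 <= z /\ z <= 2 /\ m <= s * (1 - z / 2) ^+ 2].

Lemma measurable_shell_section (s m t : R) :
  measurable (shell_section s m t : set (measurableTypeR R)).
Proof.
have ms : measurable_fun [set: R] (fun z : R => t + z ^+ 2).
  by apply: measurable_funD => //; exact: measurable_funX.
apply: measurableI; first exact: measurable_lt_set.
by apply: measurableI; apply: measurable_le_set => //; exact: measurable_funM.
Qed.

Lemma section_bounds (s s0 m t : R) : 0 <= s -> s < s0 -> 0 <= t -> s0 * t <= m ->
  (lebesgue_measure (cone_section s m) <=
     lebesgue_measure (shell_section s m t))%E /\
  (lebesgue_measure (shell_section s m t) <=
     (Num.sqrt (1 - s / s0))^-1%:E * lebesgue_measure (cone_section s m))%E.
Proof.
move=> s_ge0 ss0 t0 s0tm.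
have s0_gt0 : 0 < s0 by exact: le_lt_trans ss0.
set c := Num.sqrt _.
have k1 : s / s0 < 1 by rewrite ltr_pdivrMr// mul1r.
have c0 : 0 < c by rewrite sqrtr_gt0 subr_gt0.
(* If [s < m], then Q exceeds s |x|^2 whenever |x| <= 1, and (p, q) lies outside the base of the
   cone: both sections are empty. *)
have [sm|ms] := ltP s m.
  have -> : shell_section s m t = set0.
    by rewrite -subset0 => z -[_ [tz]] /=; nra.
  have -> : cone_section s m = set0.
    rewrite -subset0 => z -[z0 [z2]] /=.
    have : (1 - z / 2) ^+ 2 <= 1 by nra.
    by nra.
  by rewrite measure0 mule0.
(* [W] is [m / s]. For [s = 0] the hypotheses force [m = 0], and [W = 0] makes both sides of the
   equivalence true. *)
have [W [W0 W1 mW tW]] : exists W, [/\ 0 <= W, W <= 1,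
    forall y, 0 <= y -> (m <= s * y) = (W <= y) & t <= W * (s / s0)].
  have [sp|sn|s_0] := ltgtP 0 s; last first.
  - exists 0; rewrite -s_0 in ms *.
    have m0 : m = 0 by nra.
    split => //; first by move=> y y0; rewrite mul0r m0 lexx y0.
    by rewrite mul0r; nra.
  - by move: sn; rewrite ltNge s_ge0.
  - exists (m / s); split.
    + by rewrite divr_ge0// (le_trans _ s0tm)// mulr_ge0// ltW.
    + by rewrite ler_pdivrMr// mul1r.
    + by move=> y _; rewrite ler_pdivrMr// mulrC.
    + rewrite mulrA divfK ?gt_eqF// ler_pdivlMr// mulrC//.
have tW' : t <= W by apply: (le_trans tW); rewrite ler_piMr// ltW.
set r := Num.sqrt W; set alpha := Num.sqrt (W - t).
set beta := Num.sqrt (1 - t).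
have r2 : r ^+ 2 = W by rewrite sqr_sqrtr.
have a2 : alpha ^+ 2 = W - t by rewrite sqr_sqrtr ?subr_ge0.
have b2 : beta ^+ 2 = 1 - t by rewrite sqr_sqrtr ?subr_ge0 ?(le_trans tW').
have c2 : c ^+ 2 = 1 - s / s0 by rewrite sqr_sqrtr// subr_ge0 ltW.
have r0 : 0 <= r by exact: sqrtr_ge0.
have alpha0 : 0 <= alpha by exact: sqrtr_ge0.
have beta0 : 0 <= beta by exact: sqrtr_ge0.
have r1 : r <= 1 by nra.
have ab : alpha <= beta by rewrite ler_sqrt ?subr_ge0 ?lerB// (le_trans tW').
have -> : cone_section s m = `[0, 2 * (1 - r)]%classic.
  apply/seteqP; split => z; rewrite /cone_section /= in_itv/= mW ?sqr_ge0//.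
    by move=> -[z0 [z2 Wz]]; apply/andP; split => //; nra.
  by move=> /andP[z0 zr]; do 2?split => //; nra.
have meas_ab : lebesgue_measure `]alpha, beta]%classic = (beta - alpha)%:E.
  exact: lebesgue_measure_itv_le.
have meas_ba : lebesgue_measure `[- beta, - alpha[%classic = (beta - alpha)%:E.
  by rewrite lebesgue_measure_itv_le ?lerN2// opprK addrC.
have meas_ab' : lebesgue_measure `[alpha, beta]%classic = (beta - alpha)%:E.
  exact: lebesgue_measure_itv_le.
have meas_ba' : lebesgue_measure `[- beta, - alpha]%classic = (beta - alpha)%:E.
  by rewrite lebesgue_measure_itv_le ?lerN2// opprK addrC.
have meas_le (A : set (measurableTypeR R)) : measurable A ->
    A `<=` shell_section s m t ->
    (lebesgue_measure A <= lebesgue_measure (shell_section s m t))%E.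
  by move=> mA AC; apply: le_measure; rewrite ?inE//; exact: measurable_shell_section.
(* The half-open intervals are disjoint and avoid [z = 0], which the section misses when [t = 0]. *)
have lower : ((2 * (beta - alpha))%:E <= lebesgue_measure (shell_section s m t))%E.
  apply: (@le_trans _ _ (lebesgue_measure
      (`]alpha, beta] `|` `[- beta, - alpha[)%classic)).
    rewrite measureU//; last first.
      rewrite -subset0 => z [] /=; rewrite !in_itv/= => /andP[z1 _] /andP[_ z2].
      lra.
    by rewrite [X in (_ <= X + _)%E]meas_ab [X in (_ <= _ + X)%E]meas_ba
      -EFinD lee_fin; lra.
  apply: meas_le; first exact: measurableU.
  have key z : alpha < z -> z <= beta -> shell_section s m t z.
    move=> z1 z2; have ? : alpha ^+ 2 < z ^+ 2 by nra.
    have ? : z ^+ 2 <= beta ^+ 2 by nra.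
    by do 2?split; [lra|lra|rewrite mW; lra].
  move=> z [] /=; rewrite in_itv/= => /andP[z1 z2]; first exact: key.
  by rewrite -[z]opprK /shell_section /= sqrrN; apply: key; lra.
have upper : (lebesgue_measure (shell_section s m t) <= (2 * (beta - alpha))%:E)%E.
  apply: (@le_trans _ _ (lebesgue_measure
      (`[alpha, beta] `|` `[- beta, - alpha])%classic)); last first.
    apply: (@le_trans _ _ (lebesgue_measure `[alpha, beta]%classic +
      lebesgue_measure `[(- beta)%R, (- alpha)%R]%classic)%E); first exact: measureU2.
    by rewrite [X in (X + _ <= _)%E]meas_ab' [X in (_ + X <= _)%E]meas_ba'
      -EFinD lee_fin; lra.
  apply: le_measure; rewrite ?inE//; first exact: measurable_shell_section.
    exact: measurableU.
  move=> z [tz [tz1]]; rewrite mW; last exact: ltW.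
  move=> Wtz; have [z0|z0] := leP 0 z; [left|right]; rewrite /= in_itv/=.
    by apply/andP; split; nra.
  by apply/andP; split; nra.
(* [(beta - alpha) * (beta + alpha) = 1 - W = (1 - r) * (1 + r)], and
   [c * (1 + r) <= beta + alpha <= 1 + r]. *)
have dif : (beta - alpha) * (beta + alpha) = (1 - r) * (1 + r).
  by transitivity (beta ^+ 2 - alpha ^+ 2); [ring|rewrite a2 b2 -r2; ring].
have beta1 : beta <= 1 by nra.
have alphar : alpha <= r by rewrite ler_sqrt //; lra.
(* Comparing squares, [t <= s / s0] gives [c <= beta], and [t <= s / s0 * W] gives
   [c * r <= alpha]. *)
have tk : t <= s / s0.
  by rewrite (le_trans tW)// ler_piMl// divr_ge0// ltW.
have cbeta : c <= beta.
  by rewrite -(@ler_pXn2r _ 2)// ?nnegrE ?(ltW c0)// c2 b2; lra.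
have kW : t <= s / s0 * W by rewrite mulrC.
have cralpha : c * r <= alpha.
  rewrite -(@ler_pXn2r _ 2)// ?nnegrE ?mulr_ge0 ?(ltW c0)//.
  by rewrite exprMn c2 r2 a2 mulrBl mul1r lerD2l lerN2.
have lo : 1 - r <= beta - alpha.
  rewrite leNgt; apply/negP => lt_r.
  have : 0 <= (beta - alpha) * (1 + r - (beta + alpha)) by apply: mulr_ge0; lra.
  have : 0 < (1 - r - (beta - alpha)) * (1 + r) by apply: mulr_gt0; lra.
  nra.
have up : c * (beta - alpha) <= 1 - r.
  have cr : c * (1 + r) <= beta + alpha by lra.
  have xy : (beta - alpha) * (c * (1 + r)) <= (1 - r) * (1 + r).
    by rewrite -dif ler_wpM2l ?subr_ge0.
  by rewrite -(ler_pM2r (ltr_wpDr r0 ltr01)) -mulrA mulrCA.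
rewrite lebesgue_measure_itv_le; last by nra.
rewrite subr0; split.
  by apply: le_trans lower; rewrite lee_fin; lra.
apply: (le_trans upper); rewrite -EFinM lee_fin ler_pdivlMl//; lra.
Qed.

End section_comparison.

(** * Volumes *)

Section disc_volumes.
Import numFieldNormedType.Exports.
Variable R : realType.
Notation mR := (measurableTypeR R).
Notation mu := (@lebesgue_measure R).
Notation mu2 := (@lebesgue_measure2 R).
Notation mu3 := (mu2 \x mu)%E.

Definition disc (m : R) : set (mR * mR) :=
  [set q | q.1 ^+ 2 + q.2 ^+ 2 <= m].

Lemma measurable_sqnorm2 :
  measurable_fun [set: mR * mR] (fun q => q.1 ^+ 2 + q.2 ^+ 2 : R).
Proof.
by apply: measurable_funD; apply: measurable_funX;
  [exact: measurable_fst|exact: measurable_snd].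
Qed.

Lemma measurable_disc (m : R) : measurable (disc m).
Proof. by apply: measurable_le_set => //; exact: measurable_sqnorm2. Qed.

(** The area of the unit disc is never computed: it cancels in the final quotient, for which it has
    to be positive and finite. *)
Lemma disc_area_gt0 : (0 < mu2 (disc 1))%E.
Proof.
have mI : measurable (`[0, 2^-1]%classic : set mR) by exact: measurable_itv.
apply: (@lt_le_trans _ _ (mu2 (`[0, 2^-1] `*` `[0, 2^-1])%classic)).
  rewrite [ltRHS]product_measure1E//.
  by apply: mule_gt0; rewrite [ltRHS]lebesgue_measure_itv_le// lte_fin subr0.
apply: le_measure; rewrite ?inE; [exact: measurableX|exact: measurable_disc|].
move=> [x y] [/=]; rewrite !in_itv/= /disc /= => /andP[? ?] /andP[? ?]; nra.
Qed.

Lemma disc_area_lty : (mu2 (disc 1) < +oo)%E.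
Proof.
have mI : measurable (`[-1, 1]%classic : set mR) by exact: measurable_itv.
apply: (@le_lt_trans _ _ (mu2 (`[-1, 1] `*` `[-1, 1])%classic)); last first.
  rewrite [ltLHS]product_measure1E//; apply: lte_mul_pinfty => //;
    by rewrite ?ge0_fin_numE//= lebesgue_measure_itv_le ?lerN10// ltry.
apply: le_measure; rewrite ?inE; [exact: measurable_disc|exact: measurableX|].
move=> [x y]; rewrite /disc /= !in_itv/= => xy.
by split; apply/andP; split; nra.
Qed.

(** Scaling in the plane is deduced from scaling in space, applied to the cylinder of height 1 over
    the disc and a diagonal matrix that fixes the third coordinate. *)
Lemma disc_area (m : R) : 0 <= m -> mu2 (disc m) = (m%:E * mu2 (disc 1))%E.
Proof.
rewrite le_eqVlt => /predU1P[<-|m0].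
  rewrite mul0e; apply/eqP; rewrite -measure_le0.
  have m1 : measurable ([set 0] : set mR) by exact: measurable_set1.
  apply: (@le_trans _ _ (mu2 ([set 0] `*` [set 0]))).
    apply: le_measure; rewrite ?inE; [exact: measurable_disc|exact: measurableX|].
    by move=> [x y]; rewrite /disc /= => xy; split; apply/eqP; nra.
  by rewrite [leLHS]product_measure1E// [X in (_ * X <= _)%E]lebesgue_measure_set1 mule0.
pose k := (Num.sqrt m)^-1.
have k0 : 0 < k by rewrite invr_gt0 sqrtr_gt0.
have k2 : k ^+ 2 = m^-1 by rewrite exprVn sqr_sqrtr// ltW.
pose M : 'M[R]_3 := diag_mx (\row_i (if i == 2 then 1 else k)).
have detM : \det M = m^-1.
  rewrite det_diag !big_ord_recl big_ord0 !mxE /= -k2 /=.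
  by rewrite !mulr1 expr2.
have mI : measurable (`[0, 1]%classic : set mR) by exact: measurable_itv.
have cyl r : mu3 (disc r `*` `[0, 1]%classic) = mu2 (disc r).
  rewrite product_measure1E//; last exact: measurable_disc.
  by rewrite [X in (_ * X)%E]lebesgue_measure_itv_le// subr0 mule1.
have mA : measurable (disc 1 `*` `[0, 1]%classic : set (mR * mR * mR)).
  by apply: measurableX => //; exact: measurable_disc.
have dM : \det M != 0 by rewrite detM invr_neq0// gt_eqF.
have := lebesgue_measure3_linear _ M dM _ mA; rewrite cyl detM => ->.
rewrite (_ : linmap _ M @^-1` _ = disc m `*` `[0, 1]%classic).
  by rewrite cyl muleA -EFinM gtr0_norm ?invr_gt0// divff ?gt_eqF// mul1e.
rewrite /linmap; apply/seteqP; split => -[[x y] z]; rewrite /disc /= !mxE /=;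
  rewrite !(mul1r, mulr0n, mulr1n, mul0r, addr0, add0r) !exprMn k2;
  by rewrite -mulrDr ler_pdivrMl// mulr1.
Qed.

Lemma integral_deriv_horner (p : {poly R}) (a b : R) : a < b ->
  (\int[mu]_(x in `[a, b]) (p^`().[x])%:E = (p.[b] - p.[a])%:E)%E.
Proof.
move=> ab; rewrite (@continuous_FTC2 _ _ (horner p))//.
- by apply: continuous_subspaceT => x; exact: continuous_horner.
- split; first by move=> x _; exact: derivable_horner.
  + by apply: cvg_at_right_filter; exact: continuous_horner.
  + by apply: cvg_at_left_filter; exact: continuous_horner.
- by move=> x _; rewrite derivE.
Qed.

(** Cavalieri's principle: the section at height [z] is a disc. Giving its squared radius as the
    derivative of a polynomial lets the fundamental theorem of calculus evaluate the integral. *)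
Lemma volume_disc_sections (A : set (mR * mR * mR)) (a b : R) (p : {poly R}) :
  measurable A -> a < b -> (forall z, a <= z <= b -> 0 <= p^`().[z]) ->
  (forall q z, A (q, z) <-> a <= z <= b /\ q.1 ^+ 2 + q.2 ^+ 2 <= p^`().[z]) ->
  mu3 A = ((p.[b] - p.[a])%:E * mu2 (disc 1))%E.
Proof.
move=> mA ab p0 AE; rewrite (lebesgue_measure3_zsection _ _ mA).
rewrite -(integral_deriv_horner _ _ _ ab) -ge0_integralZr//; last first.
  apply/measurable_EFinP; apply: measurable_funTS.
  by apply: continuous_measurable_fun => x; exact: continuous_horner.
rewrite [RHS]integral_mkcond; apply: eq_integral => z _; rewrite patchE.
have [zab|zab] := boolP (z \in `[a, b]%classic).
  move: zab; rewrite inE /= in_itv/= => zab.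
  rewrite -disc_area ?p0//; congr (mu2 _); apply/seteqP; split => q;
    rewrite /ysection /= !inE /disc /= => H; first by have [] := (AE q z).1 H.
  exact: (AE q z).2.
rewrite (_ : ysection A z = set0) ?measure0//.
rewrite -subset0 => q; rewrite /ysection /= inE => /AE[zab' _].
by move: zab; rewrite notin_setE /= in_itv/= zab'.
Qed.

End disc_volumes.

(** * Volumes of the circular cone, the unit ball and the shell *)

Section shell_volumes.
Variable R : realType.
Notation mR := (measurableTypeR R).
Notation mu := (@lebesgue_measure R).
Notation mu2 := (@lebesgue_measure2 R).
Notation mu3 := (mu2 \x mu)%E.

Lemma measurable_sqnorm2_fst : measurable_fun [set: mR * mR * mR]
  (fun x => x.1.1 ^+ 2 + x.1.2 ^+ 2 : R).
Proof. exact: (measurableT_comp (@measurable_sqnorm2 R) measurable_fst). Qed.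

Lemma measurable_snd_sqr : measurable_fun [set: mR * mR * mR]
  (fun x => x.2 ^+ 2 : R).
Proof. by apply: measurable_funX; exact: measurable_snd. Qed.

Lemma measurable_cone (s : R) : measurable
  [set x : mR * mR * mR | cone_section _ s (x.1.1 ^+ 2 + x.1.2 ^+ 2) x.2].
Proof.
apply: measurableI; first exact: measurable_le_set.
apply: measurableI; apply: measurable_le_set => //.
  exact: measurable_sqnorm2_fst.
apply: measurable_funM => //; apply: measurable_funX.
by apply: measurable_funB => //; exact: measurable_funM.
Qed.

Lemma cone_volume (s : R) : 0 <= s ->
  mu3 [set x | cone_section _ s (x.1.1 ^+ 2 + x.1.2 ^+ 2) x.2] =
  ((2 / 3 * s)%:E * mu2 (disc _ 1))%E.
Proof.
move=> s0.
(* The antiderivative of [s * (1 - z / 2) ^+ 2] that vanishes at 0; its value at 2 is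
   [2 / 3 * s]. *)
pose p : {poly R} := s *: ('X - 2^-1 *: 'X^2 + 12^-1 *: 'X^3).
have pE z : p^`().[z] = s * (1 - z / 2) ^+ 2.
  by rewrite /p !(derivZ, derivB, derivD, derivXn, derivX) !hornerE /=; field.
rewrite (volume_disc_sections _ _ 0 2 p)//; last 3 first.
- exact: measurable_cone.
- by move=> z _; rewrite pE mulr_ge0// sqr_ge0.
- move=> q z; rewrite pE; split; first by move=> [-> [-> ?]].
  by move=> [/andP[? ?] ?]; do 2?split.
by congr (_%:E * _)%E; rewrite /p !hornerE /=; field.
Qed.

(** The cone over the whole sphere; the origin is missing because [cone] requires [0 < t]. *)
Definition punctured_ball : set (mR * mR * mR) :=
  [set x | 0 < x.1.1 ^+ 2 + x.1.2 ^+ 2 + x.2 ^+ 2 /\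
           x.1.1 ^+ 2 + x.1.2 ^+ 2 + x.2 ^+ 2 <= 1].

Lemma punctured_ball_volume :
  mu3 punctured_ball = ((4 / 3)%:E * mu2 (disc _ 1))%E.
Proof.
have mN : measurable_fun [set: mR * mR * mR]
    (fun x => x.1.1 ^+ 2 + x.1.2 ^+ 2 + x.2 ^+ 2 : R).
  by apply: measurable_funD; [exact: measurable_sqnorm2_fst|exact: measurable_snd_sqr].
have mO2 : measurable ([set (0, 0)] : set (mR * mR)).
  rewrite (_ : [set _] = [set 0] `*` [set 0]).
    by apply: measurableX; exact: measurable_set1.
  by apply/seteqP; split => -[x y] /= => [[-> ->]|[-> ->]].
have mO : measurable ([set (0, 0)] `*` [set 0] : set (mR * mR * mR)).
  by apply: measurableX => //; exact: measurable_set1.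
have mpb : measurable punctured_ball.
  by apply: measurableI; [exact: measurable_lt_set|exact: measurable_le_set].
have mO0 : mu3 ([set (0, 0)] `*` [set 0]) = 0.
  rewrite product_measure1E//.
  by rewrite [X in (_ * X)%E]lebesgue_measure_set1 mule0.
(* Adding the origin, a null set, makes the section at height 0 a full disc. *)
have -> : mu3 punctured_ball = mu3 (punctured_ball `|` [set (0, 0)] `*` [set 0]).
  exact/esym/(measureU0 mpb mO mO0).
clear mO0.
pose p : {poly R} := 'X - 3^-1 *: 'X^3.
have pE z : p^`().[z] = 1 - z ^+ 2.
  by rewrite /p !(derivZ, derivB, derivD, derivXn, derivX) !hornerE /=; field.
have p0 z : -1 <= z <= 1 -> 0 <= p^`().[z].
  by move=> /andP[? ?]; rewrite pE; nra.
rewrite (volume_disc_sections _ _ (-1) 1 p (measurableU _ _ mpb mO) _ p0).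
- by congr (_%:E * _)%E; rewrite /p !hornerE /=; field.
- by lra.
- move=> [x y] z; rewrite pE /punctured_ball /=; split.
    move=> [[_ xyz]|[[-> ->] ->]].
      by split; [apply/andP; split; nra|lra].
    by rewrite lerN10 ler01; split => //; lra.
  move=> [/andP[z1 z2] xyz].
  have : 0 <= x ^+ 2 + y ^+ 2 + z ^+ 2 by rewrite !addr_ge0 ?sqr_ge0.
  rewrite le_eqVlt => /predU1P[xyz0|xyz0]; [right|left].
    by split; [congr (_, _)|]; apply/eqP; nra.
  by split => //; lra.
Qed.

Lemma measurable_shell (s : R) (G : mR * mR -> R) : measurable_fun setT G ->
  measurable [set x : mR * mR * mR |
    shell_section _ s (x.1.1 ^+ 2 + x.1.2 ^+ 2) (G x.1) x.2].
Proof.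
move=> mG.
have mGz : measurable_fun [set: mR * mR * mR] (fun x => G x.1 + x.2 ^+ 2).
  apply: measurable_funD; last exact: measurable_snd_sqr.
  exact: measurableT_comp.
apply: measurableI; first exact: measurable_lt_set.
apply: measurableI; apply: measurable_le_set => //.
  exact: measurable_sqnorm2_fst.
exact: measurable_funM.
Qed.

Lemma shell_volume_bounds (s s0 : R) (G : mR * mR -> R) : 0 <= s -> s < s0 ->
  measurable_fun setT G -> (forall q, 0 <= G q) ->
  (forall q, s0 * G q <= q.1 ^+ 2 + q.2 ^+ 2) ->
  let V := mu3 [set x | shell_section _ s (x.1.1 ^+ 2 + x.1.2 ^+ 2) (G x.1) x.2] in
  ((2 / 3 * s)%:E * mu2 (disc _ 1) <= V /\
   V <= (Num.sqrt (1 - s / s0))^-1%:E * ((2 / 3 * s)%:E * mu2 (disc _ 1)))%E.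
Proof.
move=> s_ge0 ss0 mG G0 GQ V; rewrite -cone_volume//.
set K := [set x | cone_section _ _ _ _].
set C := [set x | shell_section _ _ _ _ _] in V *.
have mK : measurable K by exact: measurable_cone.
have mC : measurable C by exact: measurable_shell.
have secK q : xsection K q = cone_section _ s (q.1 ^+ 2 + q.2 ^+ 2).
  by apply/seteqP; split => z; rewrite /xsection /= inE.
have secC q : xsection C q = shell_section _ s (q.1 ^+ 2 + q.2 ^+ 2) (G q).
  by apply/seteqP; split => z; rewrite /xsection /= inE.
have b q := section_bounds _ s s0 (q.1 ^+ 2 + q.2 ^+ 2) _ s_ge0 ss0 (G0 q) (GQ q).
have mfK := measurable_fun_xsection mu mK.
have mfC := measurable_fun_xsection mu mC.
split.
  apply: ge0_le_integral => //= q _.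
  by rewrite secK secC; exact: (b q).1.
have c0 : 0 <= (Num.sqrt (1 - s / s0))^-1 by rewrite invr_ge0 sqrtr_ge0.
rewrite /V -[X in (_ <= _ * X)%E]/(\int[mu2]_q (mu \o xsection K) q)%E.
rewrite -ge0_integralZl//.
apply: ge0_le_integral => //= [|q _].
- exact: measurable_funeM.
- by rewrite secK secC; exact: (b q).2.
Qed.

End shell_volumes.

(** * The coordinates (x . u, x . w, x . n) *)

(** A binary form of zero discriminant is a square up to sign, and the nonnegative trace fixes the
    sign. *)
Lemma quad_form_ge0 (R : realFieldType) (A B g x y : R) : 0 <= A + B ->
  A * B = g ^+ 2 -> 0 <= A * x ^+ 2 + 2 * g * x * y + B * y ^+ 2.
Proof.
move=> AB ABg; have g2 := sqr_ge0 g.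
have [A0|A0|A0] := ltgtP 0 A.
- rewrite -(pmulr_rge0 _ A0).
  have -> : A * (A * x ^+ 2 + 2 * g * x * y + B * y ^+ 2) =
      (A * x) ^+ 2 + 2 * (A * x) * (g * y) + A * B * y ^+ 2 by ring.
  rewrite ABg (_ : _ + _ = (A * x + g * y) ^+ 2) ?sqr_ge0//; by ring.
- have B0 : 0 < B by lra.
  have : A * B < 0 by rewrite nmulr_rlt0.
  by rewrite ABg; lra.
- have /eqP : g ^+ 2 = 0 by rewrite -ABg -A0 mul0r.
  rewrite sqrf_eq0 => /eqP ->; rewrite -A0 in AB *.
  by rewrite !(mul0r, mulr0, add0r) mulr_ge0 ?sqr_ge0//; lra.
Qed.

Section cross_frame.
Variables (R : realType) (u0 u1 u2 w0 w1 w2 : R).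

(** The Gram determinant of u and w; by Lagrange's identity it is the squared length of their cross
    product. *)
Definition gram : R :=
  (u0 ^+ 2 + u1 ^+ 2 + u2 ^+ 2) * (w0 ^+ 2 + w1 ^+ 2 + w2 ^+ 2) -
  (u0 * w0 + u1 * w1 + u2 * w2) ^+ 2.

(** The last row is the cross product of u and w divided by [b], a unit normal of their plane once
    [b ^+ 2 = gram]. *)
Definition frame (b : R) : 'M[R]_3 := \matrix_(i, j)
  nth 0 (nth [::] [:: [:: u0; u1; u2]; [:: w0; w1; w2];
    [:: (u1 * w2 - u2 * w1) / b; (u2 * w0 - u0 * w2) / b;
        (u0 * w1 - u1 * w0) / b]] i) j.

(** Expansion along the last row gives the squared length of the cross product divided by [b]. *)
Lemma det_frame (b : R) : b != 0 -> b ^+ 2 = gram -> \det (frame b) = b.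
Proof.
move=> b0 b2; rewrite (expand_det_row _ 2) sum3E /cofactor.
rewrite !(expand_det_row _ ord0) !big_ord_recl !big_ord0 /cofactor !det_mx11.
rewrite !mxE /=.
apply: (mulfI b0); rewrite -expr2 b2 /gram /=.
by field.
Qed.

(* The squared length of the part of a vector lying in the span of [u] and [w],
   as a function of its inner products with [u] and [w]. *)
Definition span_sqnorm (b : R) (q : R * R) : R :=
  ((w0 ^+ 2 + w1 ^+ 2 + w2 ^+ 2) * q.1 ^+ 2 -
   2 * (u0 * w0 + u1 * w1 + u2 * w2) * q.1 * q.2 +
   (u0 ^+ 2 + u1 ^+ 2 + u2 ^+ 2) * q.2 ^+ 2) / b ^+ 2.

(** The numerator is the squared length of q.1 w - q.2 u. *)
Lemma span_sqnorm_ge0 (b : R) (q : R * R) : 0 <= span_sqnorm b q.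
Proof.
apply: divr_ge0; last exact: sqr_ge0.
rewrite (_ : _ + _ = (w0 * q.1 - u0 * q.2) ^+ 2 + (w1 * q.1 - u1 * q.2) ^+ 2 +
  (w2 * q.1 - u2 * q.2) ^+ 2); last by ring.
by rewrite !addr_ge0 ?sqr_ge0.
Qed.

(** Pythagoras for the parts of [x] in the plane of u and w and along its normal. *)
Lemma frame_sqnorm (b : R) (x : R * R * R) : b != 0 -> b ^+ 2 = gram ->
  let y := linmap _ (frame b) x in
  span_sqnorm b y.1 + y.2 ^+ 2 = x.1.1 ^+ 2 + x.1.2 ^+ 2 + x.2 ^+ 2.
Proof.
move=> b0 b2; rewrite /span_sqnorm /linmap !mxE /=.
have b20 : b ^+ 2 != 0 by rewrite sqrf_eq0.
apply: (mulfI b20); rewrite [in RHS]b2 /gram.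
by field.
Qed.

(** The Gram matrix of u and w has trace [2 * a] and determinant [b ^+ 2], so its eigenvalues are
    [s0] and the [l] of the proof. [span_sqnorm] is the form of its inverse, hence at most 1 / s0 on
    unit vectors. *)
Lemma span_sqnorm_le (b s0 : R) (q : R * R) : b != 0 -> b ^+ 2 = gram ->
  let a := 2^-1 * (u0 ^+ 2 + u1 ^+ 2 + u2 ^+ 2 + (w0 ^+ 2 + w1 ^+ 2 + w2 ^+ 2)) in
  s0 = a - Num.sqrt (a ^+ 2 - b ^+ 2) ->
  s0 * span_sqnorm b q <= q.1 ^+ 2 + q.2 ^+ 2.
Proof.
move=> b0 b2 a s0E.
have b2_gt0 : 0 < b ^+ 2 by rewrite lt_neqAle eq_sym sqrf_eq0 b0 sqr_ge0.
set D := a ^+ 2 - b ^+ 2 in s0E *.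
have D0 : 0 <= D.
  rewrite /D b2 /gram /a.
  rewrite (_ : _ - _ = (2^-1 * (u0 ^+ 2 + u1 ^+ 2 + u2 ^+ 2 -
    (w0 ^+ 2 + w1 ^+ 2 + w2 ^+ 2))) ^+ 2 + (u0 * w0 + u1 * w1 + u2 * w2) ^+ 2).
    by rewrite addr_ge0 ?sqr_ge0.
  by field.
pose l := a + Num.sqrt D.
have sD := sqr_sqrtr D0.
have s0l : s0 * l = b ^+ 2.
  transitivity (a ^+ 2 - Num.sqrt D ^+ 2); first by rewrite s0E /l; ring.
  by rewrite sD /D; ring.
have a0 : 0 <= a by rewrite /a mulr_ge0// !addr_ge0 ?sqr_ge0.
have l0 : 0 <= l by rewrite addr_ge0 ?sqrtr_ge0.
have s0_ge0 : 0 <= s0.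
  have l_gt0 : 0 < l.
    by rewrite lt_neqAle l0 andbT; apply/eqP => l_0;
      move: b2_gt0; rewrite -s0l -l_0 mulr0 ltxx.
  by rewrite -(pmulr_lge0 _ l_gt0) s0l ltW.
(* As [b ^+ 2 = s0 * l], the factor [s0] cancels, and [l] times |q|^2 minus the numerator has to be
   a nonnegative form. Its discriminant vanishes because [l] is a root of the characteristic
   polynomial of the Gram matrix. *)
rewrite /span_sqnorm mulrA ler_pdivrMr// -s0l.
rewrite [leRHS]mulrCA ler_wpM2l// -subr_ge0.
set ww := w0 ^+ 2 + _ + _; set uu := u0 ^+ 2 + _ + _; set g := u0 * w0 + _ + _.
have aE : 2 * a = uu + ww by rewrite /a -/uu -/ww; field.
rewrite (_ : _ - _ = (l - ww) * q.1 ^+ 2 + 2 * g * q.1 * q.2 +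
  (l - uu) * q.2 ^+ 2); last by ring.
apply: quad_form_ge0.
  rewrite (_ : _ + _ = 2 * Num.sqrt D) ?mulr_ge0 ?sqrtr_ge0//.
  by transitivity (2 * l - 2 * a); [rewrite aE; ring|rewrite /l; ring].
transitivity ((l - a) ^+ 2 - D + uu * ww - b ^+ 2).
  by rewrite /D; transitivity (l ^+ 2 - l * (uu + ww) + uu * ww);
    [ring|rewrite -aE; ring].
rewrite (_ : l - a = Num.sqrt D); last by rewrite /l; ring.
by rewrite sD b2 /gram -/uu -/ww -/g; ring.
Qed.

End cross_frame.

(** * Uniform points of the sphere *)

Definition coords {R : realType} (u : 3.-tuple R) : R * R * R :=
  (tnth u 0, tnth u 1, tnth u 2).

Definition sqnorm3 {R : realType} (x : R * R * R) : R :=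
  x.1.1 ^+ 2 + x.1.2 ^+ 2 + x.2 ^+ 2.

Lemma enorm_sqr (R : realType) (x : 'cV[R]_3) :
  enorm x ^+ 2 = x 0 0 ^+ 2 + x 1 0 ^+ 2 + x 2 0 ^+ 2.
Proof.
by rewrite /enorm mxE sum3E !mxE sqr_sqrtr -!expr2// !addr_ge0 ?sqr_ge0.
Qed.

(** By homogeneity x = t u satisfies Q x = t^2 Q u and |x| = t; conversely a nonzero x comes from t
    = |x| and u = x / |x|. *)
Lemma cone_sublevel (R : realType) (Q : R * R * R -> R) (s : R) :
  (forall t x y z, Q (t * x, t * y, t * z) = t ^+ 2 * Q (x, y, z)) ->
  cone [set u | Q (coords u) <= s] =
  [set x | 0 < sqnorm3 x /\ sqnorm3 x <= 1 /\ Q x <= s * sqnorm3 x].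
Proof.
move=> homQ.
have i0 : inord 0 = 0 :> 'I_3 by apply: val_inj; rewrite /= inordK.
have i1 : inord 1 = 1 :> 'I_3 by apply: val_inj; rewrite /= inordK.
have i2 : inord 2 = 2 :> 'I_3 by apply: val_inj; rewrite /= inordK.
have normE (u : 3.-tuple R) : enorm (colv u) ^+ 2 = sqnorm3 (coords u).
  by rewrite enorm_sqr !mxE.
rewrite /cone i0 i1 i2; apply/seteqP; split => [p [t [u [/andP[t0 t1] /= Qu u1 ->]]]|].
  have : sqnorm3 (coords u) = 1 by rewrite -normE u1 expr1n.
  rewrite homQ /sqnorm3 /= => N1.
  rewrite !exprMn -!mulrDr N1 mulr1; do 2?split.
  - by rewrite exprn_gt0.
  - by rewrite expr_le1// ltW.
  - by rewrite mulrC ler_pM2r ?exprn_gt0.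
move=> [[x y] z] /= [N0 [N1 Qs]].
set r := Num.sqrt (sqnorm3 (x, y, z)).
have r0 : 0 < r by rewrite sqrtr_gt0.
have r2 : r ^+ 2 = sqnorm3 (x, y, z) by rewrite sqr_sqrtr// ltW.
pose u := [tuple x / r; y / r; z / r].
have uE : coords u = (x / r, y / r, z / r) by rewrite /coords !(tnth_nth 0).
have rK c : r * (c / r) = c by rewrite mulrC divfK// gt_eqF.
exists r, u; split.
- by rewrite r0 /= -(@ler_pXn2r _ 2)// ?nnegrE ?ler01 ?(ltW r0)// expr1n r2.
- rewrite /= uE -(@ler_pM2l _ (r ^+ 2)) ?exprn_gt0// -homQ !rK r2 mulrC //.
- apply/eqP; rewrite -(@eqrXn2 _ 2)// ?ler01 ?sqrtr_ge0//; apply/eqP.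
  rewrite normE uE /sqnorm3 /= expr1n !exprMn -!mulrDl -[X in X * _]r2 exprVn.
  by rewrite divff// expf_neq0// gt_eqF.
- by rewrite !(tnth_nth 0) /= !rK.
Qed.

(** If the cross product vanishes, [u] is a multiple of [w], with ratio [u k 0 / w k 0] at any
    coordinate where [w] is nonzero; freeness excludes both this and [w = 0]. *)
Lemma free_cross_neq0 (F : fieldType) (u w : 'cV[F]_3) : free [:: u; w] ->
  u 1 0 * w 2 0 = u 2 0 * w 1 0 -> u 2 0 * w 0 0 = u 0 0 * w 2 0 ->
  u 0 0 * w 1 0 = u 1 0 * w 0 0 -> False.
Proof.
rewrite free_cons span_seq1 seq1_free => /andP[/negP uw w0] e0 e1 e2.
have dep k : w k 0 != 0 -> (forall i, u i 0 * w k 0 = u k 0 * w i 0) -> False.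
  move=> wk H; apply: uw; apply/vlineP; exists (u k 0 / w k 0).
  apply/matrixP => i j; rewrite (ord1 j) !mxE mulrAC -H mulfK//.
have [z0|/dep] := eqVneq (w 0 0) 0; last first.
  by apply=> i; case: (ord3P i) => ->.
have [z1|/dep] := eqVneq (w 1 0) 0; last first.
  by apply=> i; case: (ord3P i) => ->.
have [z2|/dep] := eqVneq (w 2 0) 0; last first.
  by apply=> i; case: (ord3P i) => ->.
move/eqP: w0; apply; apply/matrixP => i j.
by rewrite (ord1 j) mxE; case: (ord3P i) => ->.
Qed.

Lemma normc_sqr (R : rcfType) (z : complex R) :
  ComplexField.Normc.normc z ^+ 2 = complex.Re z ^+ 2 + complex.Im z ^+ 2.
Proof. by case: z => x y /=; rewrite sqr_sqrtr// addr_ge0 ?sqr_ge0. Qed.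

(** Turns the normalised surface measure into a quotient of volumes; the 4 in the denominator is 3
    times the [4 / 3] of the unit ball. *)
Lemma cone_probability (R : realType) (d : measure_display)
    (T : measurableType d) (P : probability T R)
    (oR : {RV P >-> 3.-tuple R}) (Q : R * R * R -> R) (s : R) :
  uniform_on_sphere oR -> measurable [set u : 3.-tuple R | Q (coords u) <= s] ->
  (forall t x y z, Q (t * x, t * y, t * z) = t ^+ 2 * Q (x, y, z)) ->
  P [set w | Q (coords (oR w)) <= s] =
  (3%:E * (lebesgue_measure2 R \x @lebesgue_measure R)
    [set x | 0 < sqnorm3 x /\ sqnorm3 x <= 1 /\ Q x <= s * sqnorm3 x]%R /
   (4%:E * lebesgue_measure2 R (disc R 1)))%E.
Proof.
move=> unif mQ homQ; have := unif _ mQ; rewrite /distribution /pushforward.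
rewrite /sphere_area (cone_sublevel _ _ _ homQ).
(* The whole sphere is a sublevel set of the zero form, so [cone_sublevel] also handles the
   denominator. *)
have -> : [set: 3.-tuple R] = [set u | (fun=> 0 : R) (coords u) <= 0].
  by apply/seteqP; split => u //= _; rewrite lexx.
rewrite (cone_sublevel R (fun=> 0) 0); last by move=> *; rewrite mulr0.
rewrite [in X in _ = (_ / (_ * X))%E -> _](_ : [set x | _] = punctured_ball R).
  rewrite [in X in _ = (_ / (_ * X))%E -> _]punctured_ball_volume.
  rewrite muleA -EFinM (_ : 3 * (4 / 3) = 4) //; by field.
apply/seteqP; split => x; first by move=> [N0 [N1 _]].
by move=> [N0 N1]; do 2?split; rewrite ?mul0r.
Qed.

(** * The bounds for the distribution function *)

Theorem proposition4 (R : realType) (d : measure_display)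
    (T : measurableType d) (P : probability T R)
    (oR : {RV P >-> 3.-tuple R}) (v : 'cV[complex R]_3) :
  let vRe : 'cV[R]_3 := map_mx (@complex.Re R) v in
  let vIm : 'cV[R]_3 := map_mx (@complex.Im R) v in
  let h (w : T) : complex R :=
    ((map_mx (real_complex R) (colv (oR w)))^T *m v) ord0 ord0 in
  let rho := (vRe^T *m vIm) ord0 ord0 / (enorm vRe * enorm vIm) in
  let a := 2^-1 * (enorm vRe ^+ 2 + enorm vIm ^+ 2) in
  let b := enorm vRe * enorm vIm * Num.sqrt (1 - rho ^+ 2) in
  let s0 := a - Num.sqrt (a ^+ 2 - b ^+ 2) in
  let F (s : R) : \bar R :=
    P [set w | ComplexField.Normc.normc (h w) ^+ 2 <= s] in
  uniform_on_sphere oR ->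
  free [:: vRe; vIm] ->
  forall s : R, 0 <= s < s0 ->
    ((s / (2 * b))%:E <= F s /\
     F s <= (s / (2 * b) * (1 - s / s0) `^ (- 2^-1))%:E)%E.
Proof.
move=> vRe vIm h rho a b s0 F unif fr s /andP[s_ge0 ss0].
pose u i := vRe i 0; pose w i := vIm i 0.
pose uu := u 0 ^+ 2 + u 1 ^+ 2 + u 2 ^+ 2.
pose ww := w 0 ^+ 2 + w 1 ^+ 2 + w 2 ^+ 2.
pose gr := gram _ (u 0) (u 1) (u 2) (w 0) (w 1) (w 2).
have grE : gr = (u 1 * w 2 - u 2 * w 1) ^+ 2 + (u 2 * w 0 - u 0 * w 2) ^+ 2 +
    (u 0 * w 1 - u 1 * w 0) ^+ 2 by rewrite /gr /gram; ring.
have gr_gt0 : 0 < gr.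
  rewrite lt_neqAle grE !addr_ge0 ?sqr_ge0// andbT eq_sym.
  apply/negP; rewrite !paddr_eq0 ?addr_ge0 ?sqr_ge0// !sqrf_eq0 !subr_eq0.
  move=> /andP[/andP[/eqP e0 /eqP e1] /eqP e2].
  exact: (free_cross_neq0 _ _ _ fr e0 e1 e2).
have uE : enorm vRe ^+ 2 = uu by exact: enorm_sqr.
have wE : enorm vIm ^+ 2 = ww by exact: enorm_sqr.
have innerE : (vRe^T *m vIm) ord0 ord0 = u 0 * w 0 + u 1 * w 1 + u 2 * w 2.
  by rewrite mxE sum3E /u /w !mxE.
have uuww : uu * ww = gr + (u 0 * w 0 + u 1 * w 1 + u 2 * w 2) ^+ 2.
  by rewrite /gr /gram /uu /ww; ring.
have uuww0 : 0 < uu * ww by rewrite uuww ltr_pwDl// sqr_ge0.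
(* [b] is the area of the parallelogram spanned by [vRe] and [vIm]; this makes it the determinant of
   the frame [M] below. *)
have b2 : b ^+ 2 = gr.
  have rhoE : 1 - rho ^+ 2 = gr / (uu * ww).
    rewrite /rho innerE expr_div_n exprMn uE wE.
    apply: (mulIf (lt0r_neq0 uuww0)).
    by rewrite mulrBl !divfK ?lt0r_neq0// uuww; ring.
  rewrite /b exprMn rhoE sqr_sqrtr ?divr_ge0 ?ltW// exprMn uE wE.
  by rewrite mulrC divfK// lt0r_neq0.
have b_gt0 : 0 < b.
  rewrite lt_neqAle !mulr_ge0 ?sqrtr_ge0// andbT eq_sym.
  by rewrite -sqrf_eq0 b2 gt_eqF.
have b0 : b != 0 by rewrite gt_eqF.
pose Q (x : R * R * R) := (x.1.1 * u 0 + x.1.2 * u 1 + x.2 * u 2) ^+ 2 +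
  (x.1.1 * w 0 + x.1.2 * w 1 + x.2 * w 2) ^+ 2.
have homQ t x y z : Q (t * x, t * y, t * z) = t ^+ 2 * Q (x, y, z).
  by rewrite /Q /=; ring.
have mQ : measurable [set o : 3.-tuple R | Q (coords o) <= s].
  apply: measurable_le_set => //.
  have ml (c0 c1 c2 : R) : measurable_fun [set: 3.-tuple R]
      (fun o => tnth o 0 * c0 + tnth o 1 * c1 + tnth o 2 * c2).
    by do 2?apply: measurable_funD; apply: measurable_funM => //;
      exact: measurable_tnth.
  by apply: measurable_funD; apply: measurable_funX; exact: ml.
have hE x : h x = (tnth (oR x) 0)%:C%C * v 0 0 + (tnth (oR x) 1)%:C%C * v 1 0 +
    (tnth (oR x) 2)%:C%C * v 2 0 by rewrite /h mxE sum3E !mxE.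
have hRe x : complex.Re (h x) =
    tnth (oR x) 0 * u 0 + tnth (oR x) 1 * u 1 + tnth (oR x) 2 * u 2.
  rewrite hE /u !mxE; case: (v 0 0) (v 1 0) (v 2 0) => a0 b0' [a1 b1] [a2 b2'] /=.
  by ring.
have hIm x : complex.Im (h x) =
    tnth (oR x) 0 * w 0 + tnth (oR x) 1 * w 1 + tnth (oR x) 2 * w 2.
  rewrite hE /w !mxE; case: (v 0 0) (v 1 0) (v 2 0) => a0 b0' [a1 b1] [a2 b2'] /=.
  by ring.
have FE : F s = P [set x | Q (coords (oR x)) <= s].
  by rewrite /F; under eq_set do rewrite normc_sqr hRe hIm.
rewrite FE (cone_probability _ _ _ _ _ _ _ unif mQ homQ).
set X := [set x | _].
pose G := span_sqnorm _ (u 0) (u 1) (u 2) (w 0) (w 1) (w 2) b.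
set M := frame _ (u 0) (u 1) (u 2) (w 0) (w 1) (w 2) b.
pose S := [set x | shell_section _ s (x.1.1 ^+ 2 + x.1.2 ^+ 2) (G x.1) x.2].
have XS : X = linmap _ M @^-1` S.
  have yE x : (linmap _ M x).1.1 ^+ 2 + (linmap _ M x).1.2 ^+ 2 = Q x.
    by rewrite /linmap !mxE /= /Q; ring.
  have sE x : G (linmap _ M x).1 + (linmap _ M x).2 ^+ 2 = sqnorm3 x.
    exact: frame_sqnorm.
  by apply/seteqP; split => x; rewrite /X /S /shell_section /= sE yE.
have m1 := @measurable_fst _ _ (measurableTypeR R) (measurableTypeR R).
have m2 := @measurable_snd _ _ (measurableTypeR R) (measurableTypeR R).
have mG : measurable_fun setT G.
  rewrite /G /span_sqnorm; apply: measurable_funM => //.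
  apply: measurable_funD; last by apply: measurable_funM => //; exact: measurable_funX.
  apply: measurable_funB; first by apply: measurable_funM => //; exact: measurable_funX.
  by apply: measurable_funM => //; apply: measurable_funM.
have detM : \det M = b by exact: det_frame.
have G0 q : 0 <= G q by exact: span_sqnorm_ge0.
have GQ q : s0 * G q <= q.1 ^+ 2 + q.2 ^+ 2.
  by apply: (@span_sqnorm_le _ _ _ _ _ _ _ _ _ _ b0 b2); rewrite /s0 /a uE wE.
have [] := shell_volume_bounds _ _ _ _ s_ge0 ss0 mG G0 GQ.
have mS : measurable S by exact: measurable_shell.
have dM : \det M != 0 by rewrite detM.
have := lebesgue_measure3_linear _ _ dM _ mS.
rewrite detM -XS gtr0_norm// -/S => ->.
have := disc_area_gt0 R; have := disc_area_lty R.
(* From here on the area of the unit disc is an arbitrary positive real [D]. *)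
move: (lebesgue_measure2 R (disc R 1)) => [D| |] // _; rewrite lte_fin => D0.
have c_gt0 : 0 < 1 - s / s0.
  by rewrite subr_gt0 ltr_pdivrMr ?mul1r// (le_lt_trans s_ge0).
rewrite powRN powR12_sqrt ?(ltW c_gt0)//.
set c := Num.sqrt _; have c0 : 0 < c by rewrite sqrtr_gt0.
have : (0 <= (lebesgue_measure2 R \x @lebesgue_measure R) X)%E.
  exact: measure_ge0.
(* An infinite volume would contradict the upper bound [up], so the volume is a real [V]. *)
case: (_ X) => [V _|_ + up|//]; last first.
  by move: up; rewrite gt0_muley ?lte_fin// -!EFinM leye_eq.
rewrite -!EFinM !lee_fin inver mulf_eq0 pnatr_eq0 (gt_eqF D0) /= -EFinM => lo up.
(* The probability is [3 * V / (4 * D)], whereas [lo] and [up] bound [b * V], the volume in the new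
   coordinates, by multiples of [2 / 3 * s * D]. *)
have VE : 3 * V / (4 * D) = (2 * b)^-1 * (b * V / (2 / 3 * D)).
  by field; rewrite b0 lt0r_neq0.
have k0 : 0 < (2 * b)^-1 by rewrite invr_gt0 mulr_gt0.
have D23 : 0 < 2 / 3 * D by rewrite mulr_gt0.
rewrite !lee_fin VE; split.
  by rewrite mulrC ler_pM2l// ler_pdivlMr//; lra.
rewrite (mulrC s) -[leRHS]mulrA ler_pM2l// ler_pdivrMr//; apply: (le_trans up).
by rewrite le_eqVlt; apply/orP; left; apply/eqP; ring.
Qed.
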